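(* Let $N\ge1$ and $K>0$. There exist a small enough constant $\epsilon=\epsilon(K,N)>0$ and a constant $C>0$ such that the following holds. Let $u(\xi,\tau)$ satisfy, for all $|\xi|<1$ ($\xi\in\mathbb R^N$) and $\tau\in[0,1)$, $$|\partial_\tau u-\Delta u|\le K\left(1+e^u+|\nabla u|^2\right),\qquad|\nabla(\partial_\tau u-\Delta u)|\le K\left|\nabla\left(e^u+|\nabla u|^2\right)\right|,$$ and assume that $$(1-\tau)e^{u(\xi,\tau)}+\sqrt{1-\tau}\,|\nabla u(\xi,\tau)|\le\epsilon,\qquad\forall|\xi|<1,\ \tau\in[0,1).$$ Then $$e^{u(\xi,\tau)}+|\nabla u(\xi,\tau)|\le C\epsilon,\qquad\forall|\xi|\le\frac18,\ \tau\in[0,1).$$ In particular, $e^u$ and $\nabla u$ do not blow up at $\xi=0$ and $\tau=1$.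
   Context: $u$ is a real-valued function, regular enough for the inequalities to make sense classically; $\nabla,\Delta$ are taken with respect to $\xi$. *)

(* Defs.v *)
From HB Require Import structures.
From mathcomp Require Import all_boot all_order all_algebra.
From mathcomp Require Import all_classical all_reals all_analysis.

Set Implicit Arguments.
Unset Strict Implicit.
Unset Printing Implicit Defensive.

Import Order.TTheory GRing.Theory Num.Theory.
Import numFieldNormedType.Exports.

Local Open Scope classical_set_scope.
Local Open Scope ring_scope.

(* The library norm on 'rV[R]_N is the sup norm, hence this definition. *)
Definition enorm (R : realType) (N : nat) (v : 'rV[R]_N) : R :=
  Num.sqrt (\sum_(i < N) v 0 i ^+ 2).

Definition pderiv (R : realType) (N : nat) (i : 'I_N) (f : 'rV[R]_N -> R)
  (x : 'rV[R]_N) : R := 'D_(delta_mx 0 i) f x.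

Definition grad (R : realType) (N : nat) (f : 'rV[R]_N -> R) (x : 'rV[R]_N) :
  'rV[R]_N := \row_(i < N) pderiv i f x.

Definition laplacian (R : realType) (N : nat) (f : 'rV[R]_N -> R)
  (x : 'rV[R]_N) : R := \sum_(i < N) pderiv i (pderiv i f) x.

Definition cylinder (R : realType) (N : nat) : set ('rV[R]_N * R) :=
  [set p | enorm p.1 < 1 /\ 0 <= p.2 < 1].

(* A function on the cylinder is represented by a total function
   'rV[R]_N -> R -> R whose values outside the cylinder are irrelevant.
   The time derivative is therefore taken within [0, 1): it is the right
   derivative at t = 0 and the usual derivative for 0 < t < 1. *)
Definition dtau_quotient (R : realType) (N : nat) (u : 'rV[R]_N -> R -> R)
  (x : 'rV[R]_N) (t : R) : set_system R :=
  (fun h : R => h^-1 * (u x (t + h) - u x t)) @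
    within [set h : R | 0 <= t + h < 1] (0 : R)^'.

Definition dtau (R : realType) (N : nat) (u : 'rV[R]_N -> R -> R)
  (x : 'rV[R]_N) (t : R) : R := lim (dtau_quotient u x t).

(* All spatial partial derivatives of order at most k exist on the cylinder and
   are jointly continuous there (up to and including t = 0). *)
Fixpoint Cspace (R : realType) (N : nat) (k : nat) (f : 'rV[R]_N -> R -> R) :
  Prop :=
  {within @cylinder R N, continuous (fun p : 'rV[R]_N * R => f p.1 p.2)} /\
  (if k is k'.+1 then
     forall i : 'I_N,
       (forall x t, cylinder (x, t) -> derivable (f ^~ t) x (delta_mx 0 i)) /\
       Cspace k' (fun x t => pderiv i (f ^~ t) x)
   else True).

(* Regularity for which every derivative occurring in the theorem
   exists classically: grad (dtau u - laplacian u) involves the first spatial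
   derivatives of dtau u and the spatial derivatives of u up to order 3. *)
Definition classically_regular (R : realType) (N : nat)
  (u : 'rV[R]_N -> R -> R) : Prop :=
  [/\ Cspace 3 u,
      (forall x t, cylinder (x, t) -> cvg (dtau_quotient u x t))
    & Cspace 1 (dtau u)].

Definition heat_op (R : realType) (N : nat) (u : 'rV[R]_N -> R -> R)
  (x : 'rV[R]_N) (t : R) : R := dtau u x t - laplacian (u ^~ t) x.

Definition blows_up_at (R : realType) (N : nat) (f : 'rV[R]_N -> R -> R)
  (x0 : 'rV[R]_N) (t0 : R) : Prop :=
  exists p : nat -> 'rV[R]_N * R,
    [/\ (forall n, cylinder (p n)),
        p @ \oo --> (x0, t0)
      & `|f (p n).1 (p n).2| @[n --> \oo] --> +oo].

(* Main.v *)
(* Bernstein's method and a barrier. Put W = e^u + |grad u|^2. The term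
   -2|D^2 u|^2 produced by the heat operator on |grad u|^2 absorbs every second
   derivative coming from the bound on the gradient of (d/dt - Laplacian) u, so
   that (d/dt - Laplacian) W <= C (W + W^2) with C = 2K + 2K^2, while the
   smallness assumption reads (1 - t) W <= 2 eps. The function e^(C t) d / g with
   g = 1 - t + b (1/2 - |x|^2)^2 and b, d small is a strict supersolution of this
   inequality on |x|^2 <= 1/2; it dominates W at t = 0 and at |x|^2 = 1/2, where
   g = 1 - t, and it stays bounded up to t = 1 on |x| <= 1/8. Looking at the first
   time at which W g e^(-C t) reaches d gives W < e^(C t) d / g. Since eps is
   fixed once K and N are, a uniform bound is a bound by a multiple of eps. *)

Require Import Defs.
From HB Require Import structures.
From mathcomp Require Import all_boot all_order all_algebra.
From mathcomp Require Import all_classical all_reals all_analysis.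
From mathcomp Require Import ring lra.

Set Implicit Arguments.
Unset Strict Implicit.
Unset Printing Implicit Defensive.

Import Order.TTheory GRing.Theory Num.Theory.
Import numFieldNormedType.Exports.
Local Open Scope classical_set_scope.
Local Open Scope ring_scope.

(** * Cauchy-Schwarz and the Euclidean norm *)

(** With S, A, B the three sums, B (A B - S^2) is the sum of the squares (a_i B - b_i S)^2. Dividing
    by B settles the case B > 0; if B = 0, every b_i vanishes and so does S. *)
Lemma CauchySchwarz_sum (R : realType) (n : nat) (a b : 'I_n -> R) :
  (\sum_i a i * b i) ^+ 2 <= (\sum_i a i ^+ 2) * (\sum_i b i ^+ 2).
Proof.
set S := \sum_i a i * b i; set A := \sum_i a i ^+ 2; set B := \sum_i b i ^+ 2.
have B0 : 0 <= B by apply: sumr_ge0 => i _; exact: sqr_ge0.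
have : 0 <= B * (A * B - S ^+ 2).
  have -> : B * (A * B - S ^+ 2) = \sum_i (a i * B - b i * S) ^+ 2.
    transitivity (\sum_i (B ^+ 2 * a i ^+ 2 + (- 2 * B * S) * (a i * b i)
        + S ^+ 2 * b i ^+ 2)); last by apply: eq_bigr => i _; ring.
    by rewrite !big_split -!mulr_sumr /= -/S -/A -/B; ring.
  by apply: sumr_ge0 => i _; exact: sqr_ge0.
move: B0; rewrite le_eqVlt => /predU1P[/esym B0 _|B0].
  suff -> : S = 0 by rewrite B0 mulr0 expr0n.
  rewrite /S big1// => i _; apply/eqP; rewrite mulf_eq0 -[b i == 0]sqrf_eq0.
  by rewrite (psumr_eq0P _ B0) ?eqxx ?orbT// => j _; exact: sqr_ge0.
by rewrite pmulr_rge0// subr_ge0.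
Qed.

Lemma sqr_enorm (R : realType) (N : nat) (v : 'rV[R]_N) :
  enorm v ^+ 2 = \sum_(i < N) v 0 i ^+ 2.
Proof. by rewrite sqr_sqrtr//; apply: sumr_ge0 => i _; exact: sqr_ge0. Qed.

Lemma enorm_ge0 (R : realType) (N : nat) (v : 'rV[R]_N) : 0 <= enorm v.
Proof. exact: sqrtr_ge0. Qed.

(** * One-variable calculus and exchange of derivatives *)

Lemma MVT_signed (R : realType) (f df : R -> R) (a h : R) :
  (forall s, `|s - a| <= `|h| -> is_derive s 1 f (df s)) ->
  exists2 c, `|c - a| <= `|h| & f (a + h) - f a = df c * h.
Proof.
move=> fd.
have [h0|h0] := leP 0 h.
  have ia s : s \in `[a, a + h] -> `|s - a| <= `|h|.
    by rewrite in_itv/= => /andP[? ?]; rewrite !ger0_norm//; lra.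
  have [] := @MVT_segment R f df a (a + h).
  - by rewrite lerDl.
  - by move=> s /subset_itv_oo_cc sa; apply/fd/ia.
  - apply: derivable_within_continuous => s sa.
    by have [] := fd s (ia _ sa).
  by move=> c /ia ca ->; exists c => //; ring.
have ia s : s \in `[a + h, a] -> `|s - a| <= `|h|.
  by rewrite in_itv/= => /andP[? ?]; rewrite !ler0_norm//; lra.
have [] := @MVT_segment R f df (a + h) a.
- by rewrite gerDl ltW.
- by move=> s /subset_itv_oo_cc sa; apply/fd/ia.
- apply: derivable_within_continuous => s sa.
  by have [] := fd s (ia _ sa).
by move=> c /ia ca E; exists c => //; rewrite -opprB E; ring.
Qed.

(** If [f2] were positive, [f1], which vanishes at the maximum, would be positive just to the right
    of [a], and the mean value theorem would push [f] above its maximum. *)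
Lemma second_derivative_test (R : realType) (f f1 : R -> R) (a f2 : R) :
  (\forall s \near a, is_derive (s : R) 1 f (f1 s)) ->
  is_derive a 1 f1 f2 -> (\forall s \near a, f s <= f a) ->
  f1 a = 0 /\ f2 <= 0.
Proof.
move=> /nbhs_ballP[e/= e0 fd] f1d /nbhs_ballP[e'/= e'0 fmax].
have f1a : f1 a = 0.
  pose r := Order.min e e'.
  have r0 : 0 < r by rewrite lt_min e0 e'0.
  have ba t : t \in `]a - r, a + r[ -> ball a r t.
    by rewrite in_itv/= /ball/= ltr_distlC.
  have be t : ball a r t -> ball a e t.
    by apply: le_ball; rewrite ge_min lexx.
  have be' t : ball a r t -> ball a e' t.
    by apply: le_ball; rewrite ge_min lexx orbT.
  have := @derive1_at_max R f (a - r) (a + r) a.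
  case=> [| t /ba /be/fd [] // | | t /ba/be'/fmax //|].
  - by lra.
  - by rewrite in_itv/=; apply/andP; split; lra.
  have [_ <-] := fd a (ballxx _ e0) => _ E; exact: E.
split=> //; rewrite leNgt; apply/negP => f20.
have [f1der f1v] := f1d.
have : (fun h => h^-1 *: ((f1 \o shift a) (h *: 1) - f1 a)) @ 0^' --> f2.
  by rewrite -f1v.
move=> /cvgr_gt /(_ 0 f20).
rewrite /dnbhs near_withinE => /nbhs_ballP[d/= d0 Hd].
have [h [h0 he he' hd]] : exists h, [/\ 0 < h, h < e, h < e' & h < d].
  have m0 : 0 < Order.min (Order.min e e') d by rewrite !lt_min e0 e'0 d0.
  exists (Order.min (Order.min e e') d / 2).
  have hm : Order.min (Order.min e e') d / 2 < Order.min (Order.min e e') d.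
    by lra.
  by move: (hm); rewrite divr_gt0// !lt_min => /andP[/andP[-> ->] ->].
have fd' s : s \in `[a, a + h] -> is_derive s 1 f (f1 s).
  rewrite in_itv/= => /andP[? ?]; apply: fd.
  by rewrite /ball/= distrC ger0_norm; lra.
have aah : a < a + h by rewrite ltrDl.
have fd'' s : s \in `]a, a + h[ -> is_derive s 1 f (f1 s).
  by move=> /subset_itv_oo_cc; exact: fd'.
have fc : {within `[a, a + h], continuous f}.
  by apply: derivable_within_continuous => s /fd' [].
have [c] := MVT aah fd'' fc.
rewrite in_itv/= => /andP[ac ch] E.
have : 0 < f1 c.
  have ca0 : 0 < c - a by rewrite subr_gt0.
  have := Hd (c - a); rewrite /ball/= sub0r normrN gtr0_norm//.
  have cad : c - a < d by lra.
  move=> /(_ cad (lt0r_neq0 ca0)).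
  by rewrite [(c - a)%:A]mulr1 subrK f1a subr0 pmulr_rgt0// invr_gt0.
have : f (a + h) <= f a.
  by apply: fmax; rewrite /ball/= opprD addrA subrr sub0r normrN gtr0_norm.
move: E; rewrite [a + h - a]addrAC subrr add0r => E fa f1c.
by have := mulr_gt0 f1c h0; rewrite -E subr_gt0 ltNge fa.
Qed.

Lemma is_derive_cvg (R : realType) (f : R -> R) (a l : R) :
  (fun h : R => h^-1 * (f (h + a) - f a)) @ 0^' --> l -> is_derive a 1 f l.
Proof.
move=> fl.
have {}fl : h^-1 *: ((f \o shift a) (h *: 1) - f a) @[h --> 0^'] --> l.
  suff -> : (fun h : R => h^-1 *: ((f \o shift a) (h *: 1) - f a)) =
    (fun h => h^-1 * (f (h + a) - f a)) by [].
  by apply/funext => h /=; rewrite [h%:A]mulr1.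
by split; [exact: cvgP fl|exact: cvg_lim fl].
Qed.

Lemma cvg_is_derive (R : realType) (f : R -> R) (a l : R) :
  is_derive a 1 f l -> (fun h : R => h^-1 * (f (h + a) - f a)) @ 0^' --> l.
Proof.
move=> [fd fl].
suff -> : (fun h => h^-1 * (f (h + a) - f a)) =
  (fun h : R => h^-1 *: ((f \o shift a) (h *: 1) - f a)) by rewrite -fl.
by apply/funext => h /=; rewrite [h%:A]mulr1.
Qed.

(** Peano's form of the symmetry of mixed derivatives: the existence of the second mixed derivative
    is a conclusion. This is what gives the time derivative of grad u, since the regularity class
    only provides the spatial derivatives of [dtau u]. *)
Lemma is_derive_swap (R : realType) (f ft fts : R -> R -> R) (fs : R -> R)
    (a b : R) :
  (\forall p \near (a, b), is_derive (p.2 : R) 1 (f p.1) (ft p.1 p.2)) ->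
  (\forall p \near (a, b), is_derive (p.1 : R) 1 (ft ^~ p.2) (fts p.1 p.2)) ->
  {for (a, b), continuous (fun p => fts p.1 p.2)} ->
  (\forall t \near b, is_derive a 1 (f ^~ t) (fs t)) ->
  is_derive b 1 fs (fts a b).
Proof.
move=> ftP ftsP ftsc fsP; apply: is_derive_cvg; apply/cvgrPdist_le => e e0.
have ftse : \forall p \near (a, b), `|fts a b - fts p.1 p.2| <= e.
  by move/cvgrPdist_le : ftsc; exact.
have [r/= r0 H] : exists2 r : R, 0 < r &
    forall s t : R, `|s - a| < r -> `|t - b| < r ->
    [/\ is_derive t 1 (f s) (ft s t), is_derive s 1 (ft ^~ t) (fts s t),
        `|fts a b - fts s t| <= e & is_derive a 1 (f ^~ t) (fs t)].
  have fsP' : \forall p \near (a, b), is_derive a 1 (f ^~ p.2) (fs p.2).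
    exact: (@cvg_snd _ _ (nbhs a) (nbhs b) _ _ fsP).
  have : \forall p \near (a, b),
      [/\ is_derive (p.2 : R) 1 (f p.1) (ft p.1 p.2),
          is_derive (p.1 : R) 1 (ft ^~ p.2) (fts p.1 p.2),
          `|fts a b - fts p.1 p.2| <= e & is_derive a 1 (f ^~ p.2) (fs p.2)].
    by near=> p; split; near: p.
  move=> /nbhs_ballP[r/= r0 H]; exists r => // s t sa tb.
  by apply: (H (s, t)); split; rewrite /ball/= distrC.
rewrite /dnbhs near_withinE; apply/nbhs_ballP; exists r => // h.
rewrite /ball/= sub0r normrN => hr h0.
(* The increment of [g] over [k] is a double difference of [f]. The mean value theorem, once in t
   and once in s, makes it [fts s t * k * h] at a point near (a, b); letting k tend to 0 with h
   fixed keeps the bound by e. *)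
pose g s := f s (h + b) - f s b.
have hb : `|h + b - b| < r by rewrite addrK.
have bb : `|b - b| < r by rewrite subrr normr0.
have aa : `|a - a| < r by rewrite subrr normr0.
have gd : is_derive a 1 g (fs (h + b) - fs b).
  have [_ _ _ d1] := H _ _ aa hb; have [_ _ _ d2] := H _ _ aa bb.
  exact: is_deriveB.
have gq := cvg_is_derive gd.
have gq' : `|fts a b - h^-1 * ((k : R)^-1 * (g (k + a) - g a))|
    @[k --> (0 : R)^'] --> `|fts a b - h^-1 * (fs (h + b) - fs b)|.
  by apply: cvg_norm; apply: cvgB; [exact: cvg_cst|exact: cvgMl_tmp gq].
apply: (cvgr_to_le gq').
rewrite /dnbhs near_withinE; apply/nbhs_ballP; exists r => // k.
rewrite /ball/= sub0r normrN => kr k0.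
have [|t tb E] := @MVT_signed _ (fun t => f (k + a) t - f a t)
    (fun t => ft (k + a) t - ft a t) b h.
  move=> t tb; have tr := le_lt_trans tb hr.
  have kaa : `|k + a - a| < r by rewrite addrK.
  have [d1 _ _ _] := H _ _ kaa tr; have [d2 _ _ _] := H _ _ aa tr.
  exact: is_deriveB.
have tr := le_lt_trans tb hr.
have [|s sa E'] := @MVT_signed _ (ft ^~ t) (fts ^~ t) a k.
  by move=> s sa; have [] := H s t (le_lt_trans sa kr) tr.
have sr := le_lt_trans sa kr.
have [_ _ le_e _] := H s t sr tr.
suff -> : h^-1 * (k^-1 * (g (k + a) - g a)) = fts s t by [].
have -> : g (k + a) - g a = fts s t * k * h.
  by rewrite -E' [a + k]addrC -E /g [b + h]addrC; ring.
by field; apply/andP.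
Unshelve. all: by end_near. Qed.

(** * Directional derivatives along lines *)

(** Along a path that is affine with velocity [v], the one-variable difference quotient is the very
    same function as the directional one. *)
Lemma is_derive_path (R : realType) (V : normedModType R) (f : V -> R)
    (p : R -> V) (v : V) (s d : R) :
  (forall h, p (h + s) = h *: v + p s) ->
  is_derive (p s) v f d -> is_derive s 1 (f \o p) d.
Proof.
move=> ps [fd <-].
suff E : (fun h : R => h^-1 *: (((f \o p) \o shift s) (h *: 1) - (f \o p) s)) =
    (fun h : R => h^-1 *: ((f \o shift (p s)) (h *: v) - f (p s))).
  by split; rewrite /derivable/derive E.
by apply/funext => h /=; rewrite [h%:A]mulr1 ps.
Qed.

Lemma is_derive_of_line (R : realType) (V : normedModType R) (f : V -> R)
    (x v : V) (d : R) :
  is_derive (0 : R) 1 (fun s : R => f (x + s *: v)) d -> is_derive x v f d.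
Proof.
move=> [fd <-].
suff E : (fun h : R => h^-1 *: (((fun s : R => f (x + s *: v)) \o shift 0)
      (h *: 1) - f (x + 0 *: v))) =
    (fun h : R => h^-1 *: ((f \o shift x) (h *: v) - f x)).
  by split; rewrite /derivable/derive -E.
by apply/funext => h /=; rewrite [h%:A]mulr1 addr0 scale0r addr0 [x + _]addrC.
Qed.

Lemma is_derive_line (R : realType) (V : normedModType R) (f : V -> R)
    (x v : V) (s d : R) :
  is_derive (x + s *: v) v f d ->
  is_derive s 1 (fun s : R => f (x + s *: v)) d.
Proof.
apply: (is_derive_path (p := fun s => x + s *: v)) => h.
by rewrite scalerDl addrCA.
Qed.

(** Restricting to a line reduces this to the one-variable chain rule, so [g] only has to be
    differentiable in the direction [v]. *)
Lemma is_derive_comp1 (R : realType) (V : normedModType R) (f : R -> R)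
    (g : V -> R) (x v : V) (a b : R) :
  is_derive (g x) 1 f a -> is_derive x v g b -> is_derive x v (f \o g) (a * b).
Proof.
move=> fa gb; apply: is_derive_of_line.
apply: (@is_derive1_comp _ f (fun s => g (x + s *: v))).
  by rewrite scale0r addr0.
by apply: is_derive_line; rewrite scale0r addr0.
Qed.

Lemma is_derive_pderiv (R : realType) (N : nat) (v : 'rV[R]_N -> R)
    (i j : 'I_N) (x : 'rV[R]_N) :
  (\forall y \near x, [/\ derivable v y (delta_mx 0 i),
     derivable v y (delta_mx 0 j) &
     derivable (pderiv j v) y (delta_mx 0 i)]) ->
  {for x, continuous (pderiv i (pderiv j v))} ->
  is_derive x (delta_mx 0 j) (pderiv i v) (pderiv i (pderiv j v) x).
Proof.
set ei := delta_mx 0 i; set ej := delta_mx 0 j => vd vc.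
(* [is_derive_swap] is applied on the plane through x spanned by the two coordinate directions. *)
pose p (q : R * R) : 'rV[R]_N := x + q.2 *: ej + q.1 *: ei.
have p0 : p (0, 0) = x by rewrite /p /= !scale0r !addr0.
have pc : {for (0, 0), continuous p}.
  apply: cvgD; last by apply: cvgZr_tmp; exact: cvg_fst.
  by apply: cvgD; [exact: cvg_cst|apply: cvgZr_tmp; exact: cvg_snd].
have near_p (P : 'rV[R]_N -> Prop) : (\forall y \near x, P y) ->
    \forall q \near (0 : R, 0 : R), P (p q).
  by rewrite -p0 => /pc.
have vd' := vd; have {}vd := near_p _ vd.
apply: is_derive_of_line.
have := @is_derive_swap R (fun s r => v (p (s, r)))
  (fun s r => pderiv j v (p (s, r)))
  (fun s r => pderiv i (pderiv j v) (p (s, r)))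
  (fun r => pderiv i v (x + r *: ej)) 0 0.
rewrite p0; apply.
- apply: filterS vd => -[s r] /= [_ /derivableP d _].
  apply: (is_derive_path (p := fun r => p (s, r))) d => h.
  by rewrite /p/= scalerDl -!addrA addrCA.
- apply: filterS vd => -[s r] /= [_ _ /derivableP d].
  apply: (is_derive_path (p := fun s => p (s, r))) d => h.
  by rewrite /p/= scalerDl addrCA.
- apply: (@continuous_comp _ _ _ p (pderiv i (pderiv j v))).
    exact: pc.
  by rewrite p0.
- have rc : {for 0, continuous (fun r : R => x + r *: ej)}.
    by apply: cvgD; [exact: cvg_cst|apply: cvgZr_tmp; exact: cvg_id].
  have : \forall r \near (0 : R), derivable v (x + r *: ej) ei.
    have nx : \forall y \near x + 0 *: ej, derivable v y ei.
      by rewrite scale0r addr0; apply: filterS vd' => y [].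
    exact: (rc _ nx).
  apply: filterS => r /derivableP.
  rewrite -[X in is_derive X]addr0 -(scale0r ei).
  exact: is_derive_line.
Qed.

(** * Continuity and interior points of the cylinder *)

Lemma cvg_bigsum (R : realType) (T : Type) (F : set_system T) (I : Type)
    (r : seq I) (f : I -> T -> R) (l : I -> R) {FF : Filter F} :
  (forall i, f i @ F --> l i) ->
  (fun x => \sum_(i <- r) f i x) @ F --> \sum_(i <- r) l i.
Proof.
move=> fl; elim: r => [|i r IH].
  by rewrite big_nil; under eq_fun do rewrite big_nil; exact: cvg_cst.
by rewrite big_cons; under eq_fun do rewrite big_cons; exact: cvgD.
Qed.

Lemma continuous_enorm (R : realType) (N : nat) : continuous (@enorm R N).
Proof.
move=> x; pose f (v : 'rV[R]_N) := \sum_(i < N) v 0 i ^+ 2.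
apply: (@continuous_comp _ _ _ f Num.sqrt); last exact: sqrt_continuous.
apply: (cvg_bigsum (F := nbhs x)) => i.
by apply: cvgM; exact: coord_continuous.
Qed.

Lemma near_enorm_lt (R : realType) (N : nat) (x : 'rV[R]_N) (r : R) :
  enorm x < r -> \forall y \near x, enorm y < r.
Proof. exact: (cvgr_lt (F := nbhs x) _ (@continuous_enorm R N x)). Qed.

Lemma near_itvoo01 (R : realType) (t : R) :
  0 < t < 1 -> \forall s \near t, 0 < s < 1.
Proof.
by move=> t01; have := @near_in_itvoo R 0 1 t; rewrite in_itv/=; apply.
Qed.

Lemma cylinder_interior (R : realType) (N : nat) (x : 'rV[R]_N) (t : R) :
  enorm x < 1 -> 0 < t < 1 -> (cylinder (R := R) (N := N))° (x, t).
Proof.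
move=> x1 t01.
have nx : \forall p \near (x, t), enorm p.1 < 1.
  exact: (@cvg_fst _ _ (nbhs x) (nbhs t) _ _ (near_enorm_lt x1)).
have nt : \forall p \near (x, t), 0 < p.2 < 1.
  exact: (@cvg_snd _ _ (nbhs x) (nbhs t) _ _ (near_itvoo01 t01)).
by apply: filterS2 nx nt => p ? /andP[/ltW ? ?]; split=> //; apply/andP.
Qed.

(** At t = 0 continuity holds only relative to the cylinder. Plain continuity, and with it the
    exchange of derivatives, is available for t > 0. *)
Lemma cylinder_continuous (R : realType) (N : nat) (f : 'rV[R]_N * R -> R)
    (x : 'rV[R]_N) (t : R) :
  {within @cylinder R N, continuous f} -> enorm x < 1 -> 0 < t < 1 ->
  {for (x, t), continuous f}.
Proof.
move=> /subspace_continuousP fc x1 t01.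
have xt := cylinder_interior x1 t01.
have := fc _ (interior_subset xt).
by rewrite within_interior.
Qed.

(** * Regularity classes and mixed derivatives *)

(** Returns a function of space and time again, so that it can be iterated and fed back to
    [Cspace]. *)
Definition dx (R : realType) (N : nat) (i : 'I_N) (f : 'rV[R]_N -> R -> R)
  (x : 'rV[R]_N) (t : R) : R := pderiv i (f ^~ t) x.

Section Cspace.
Context (R : realType) (N : nat).
Implicit Types (f : 'rV[R]_N -> R -> R) (x : 'rV[R]_N) (t : R) (i j : 'I_N).

Lemma Cspace_continuous k f : Cspace k f ->
  {within @cylinder R N, continuous (fun p => f p.1 p.2)}.
Proof. by case: k => [|k] []. Qed.

Lemma Cspace_dx k f i : Cspace k.+1 f -> Cspace k (dx i f).
Proof. by move=> [_ /(_ i)[]]. Qed.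

Lemma Cspace_le k m f : (k <= m)%N -> Cspace m f -> Cspace k f.
Proof.
elim: m k f => [|m IH] [|k] f //; first by move=> _ [].
move=> km [fc fd]; split=> // i; have [d c] := fd i.
by split=> //; exact: IH.
Qed.

Lemma Cspace_derivable k f i x t : Cspace k.+1 f -> enorm x < 1 ->
  0 <= t < 1 -> is_derive x (delta_mx 0 i) (f ^~ t) (dx i f x t).
Proof. by move=> [_ /(_ i)[fd _]] x1 t01; apply/derivableP/fd. Qed.

Lemma Cspace_dxC f i j x t : Cspace 2 f -> enorm x < 1 -> 0 < t < 1 ->
  dx j (dx i f) x t = dx i (dx j f) x t.
Proof.
move=> fC x1 t01.
suff [] : is_derive x (delta_mx 0 j) (dx i f ^~ t) (dx i (dx j f) x t) by [].
apply: is_derive_pderiv.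
  have t01' : 0 <= t < 1 by case/andP: t01 => /ltW -> ->.
  apply: filterS (near_enorm_lt x1) => y y1.
  have f2 := Cspace_dx j fC.
  by split; [case: (Cspace_derivable i fC y1 t01')
    |case: (Cspace_derivable j fC y1 t01')
    |case: (Cspace_derivable i f2 y1 t01')].
have c := Cspace_continuous (Cspace_dx i (Cspace_dx j fC)).
have {}c := cylinder_continuous c x1 t01.
apply: (@continuous_comp _ _ _ (fun y => (y, t))
  (fun p => dx i (dx j f) p.1 p.2)) c.
by apply: (cvg_pair (F := nbhs x) (G := nbhs x) (H := nbhs t));
  [exact: cvg_id|exact: cvg_cst].
Qed.

(** Two exchanges: the outer one for the function [dx j f], then the inner one, which holds on a
    whole neighbourhood of x and may therefore be differentiated once more. *)
Lemma Cspace_dxxC f i j x t : Cspace 3 f -> enorm x < 1 -> 0 < t < 1 ->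
  dx i (dx j (dx j f)) x t = dx j (dx j (dx i f)) x t.
Proof.
move=> fC x1 t01; rewrite (Cspace_dxC j i (Cspace_dx j fC) x1 t01).
apply: near_eq_derive; apply: filterS (near_enorm_lt x1) => y y1.
exact: Cspace_dxC (Cspace_le (leqnSn 2) fC) y1 t01.
Qed.

(** For 0 < t < 1 the restriction in [dtau_quotient] holds for all |h| < min(t, 1 - t), so its limit
    is the two-sided derivative. *)
Lemma is_derive_dtau f x t : cvg (dtau_quotient f x t) -> enorm x < 1 ->
  0 < t < 1 -> is_derive t 1 (f x) (dtau f x t).
Proof.
move=> fd x1 /andP[t0 t1]; apply: is_derive_cvg.
have : dtau_quotient f x t --> dtau f x t by [].
rewrite /dtau_quotient; move: (dtau f x t) => l fl P /fl /= lP.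
have t01 : \forall h \near (0 : R)^', 0 <= t + h < 1.
  apply: nbhs_dnbhs; apply/nbhs_ballP; exists (Num.min t (1 - t)) => /=.
    by rewrite lt_min t0 subr_gt0.
  move=> h; rewrite /ball/= sub0r normrN lt_min !ltr_norml.
  by move=> /andP[/andP[? ?] /andP[? ?]]; apply/andP; split; lra.
move: lP; rewrite !near_simpl /within /=; apply: filterS2 t01 => h ht /(_ ht).
by rewrite /= [t + h]addrC.
Qed.

(** [is_derive_swap] in the two variables s and t, along the line x + s e_i. *)
Lemma is_derive_dx_dtau f i x t :
  (forall x t, cylinder (x, t) -> cvg (dtau_quotient f x t)) ->
  Cspace 1 f -> Cspace 1 (dtau f) -> enorm x < 1 -> 0 < t < 1 ->
  is_derive t 1 (dx i f x) (dx i (dtau f) x t).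
Proof.
move=> fd fC tC x1 t01; set ei : 'rV[R]_N := delta_mx 0 i.
pose p (q : R * R) : 'rV[R]_N * R := (x + q.1 *: ei, q.2).
have p0 : p (0, t) = (x, t) by rewrite /p /= scale0r addr0.
have pc : {for (0, t), continuous p}.
  apply: (cvg_pair (F := nbhs (0 : R, t)) (G := nbhs (x + 0 *: ei)) (H := nbhs t));
    last exact: cvg_snd.
  by apply: cvgD; [exact: cvg_cst|apply: cvgZr_tmp; exact: cvg_fst].
have pO : \forall q \near (0 : R, t), enorm (p q).1 < 1 /\ 0 < (p q).2 < 1.
  have : \forall y \near p (0, t), enorm y.1 < 1 /\ 0 < y.2 < 1.
    rewrite p0; near=> y; split; near: y.
      exact: (@cvg_fst _ _ (nbhs x) (nbhs t) _ _ (near_enorm_lt x1)).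
    exact: (@cvg_snd _ _ (nbhs x) (nbhs t) _ _ (near_itvoo01 t01)).
  by move=> /pc.
have := @is_derive_swap R (fun s r => f (p (s, r)).1 (p (s, r)).2)
  (fun s r => dtau f (p (s, r)).1 (p (s, r)).2)
  (fun s r => dx i (dtau f) (p (s, r)).1 (p (s, r)).2)
  (dx i f x) 0 t.
rewrite p0; apply.
- apply: filterS pO => -[s r] /= [sx r01].
  apply: is_derive_dtau => //; apply: fd.
  by split=> //=; case/andP: r01 => /ltW -> ->.
- apply: filterS pO => -[s r] /= [sx /andP[r0 r1]].
  apply: (@is_derive_line _ _ (dtau f ^~ r) x ei).
  by apply: (Cspace_derivable i tC sx); rewrite (ltW r0).
- apply: (@continuous_comp _ _ _ p (fun q => dx i (dtau f) q.1 q.2)).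
    exact: pc.
  have c := Cspace_continuous (Cspace_dx i tC).
  by rewrite p0; exact: cylinder_continuous c x1 t01.
- apply: (filterS (F := nbhs t)) (near_itvoo01 t01) => r /andP[r0 r1].
  apply: (@is_derive_line _ _ (f ^~ r) x ei); rewrite scale0r addr0.
  by apply: (Cspace_derivable i fC x1); rewrite (ltW r0).
Unshelve. all: by end_near. Qed.
End Cspace.

(** * Bernstein's method: algebra and rules of differentiation *)

Lemma dot_le (R : realType) (n : nat) (a b : 'I_n -> R) (p q : R) :
  0 <= p -> 0 <= q -> \sum_i a i ^+ 2 <= p ^+ 2 -> \sum_i b i ^+ 2 <= q ^+ 2 ->
  \sum_i a i * b i <= p * q.
Proof.
move=> p0 q0 ap bq; apply: le_trans (ler_norm _) _.
rewrite -(@ler_pXn2r _ 2%N)// ?nnegrE ?mulr_ge0//.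
rewrite real_normK ?num_real// exprMn (le_trans (CauchySchwarz_sum _ _))//.
by apply: ler_pM => //; apply: sumr_ge0 => i _; exact: sqr_ge0.
Qed.

(** Dictionary: [z] is e^u, [a] is grad u, [H] the Hessian, [F] the heat operator of u and [G] its
    gradient. The sum multiplied by K^2 is |grad W|^2. *)
Lemma bernstein_algebra (R : realType) (n : nat) (K z F : R)
    (a G : 'I_n -> R) (H : 'I_n -> 'I_n -> R) :
  let w := \sum_i a i ^+ 2 in
  0 <= K -> 0 <= z -> F <= K * (1 + z + w) ->
  \sum_i G i ^+ 2
    <= K ^+ 2 * \sum_i (z * a i + \sum_j 2 * a j * H i j) ^+ 2 ->
  z * F - z * w + 2 * \sum_i a i * G i - 2 * \sum_i \sum_j H i j ^+ 2
    <= (2 * K + 2 * K ^+ 2) * ((z + w) + (z + w) ^+ 2).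
Proof.
move=> w K0 z0 FK GK.
have w0 : 0 <= w by apply: sumr_ge0 => i _; exact: sqr_ge0.
pose b i := \sum_j a j * H i j.
set S := \sum_i \sum_j H i j ^+ 2.
have S0 : 0 <= S.
  by apply: sumr_ge0 => i _; apply: sumr_ge0 => j _; exact: sqr_ge0.
have bS : \sum_i b i ^+ 2 <= w * S.
  by rewrite mulr_sumr; apply: ler_sum => i _; exact: CauchySchwarz_sum.
pose p := Num.sqrt w; pose d := Num.sqrt S.
have p0 : 0 <= p by exact: sqrtr_ge0.
have d0 : 0 <= d by exact: sqrtr_ge0.
have wE : w = p ^+ 2 by rewrite sqr_sqrtr.
have SE : S = d ^+ 2 by rewrite sqr_sqrtr.
have ab : \sum_i a i * b i <= p * (p * d).
  by apply: dot_le; rewrite ?mulr_ge0// ?exprMn -?wE -?SE.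
have vE : \sum_i (z * a i + \sum_j 2 * a j * H i j) ^+ 2 =
    z ^+ 2 * w + 4 * z * (\sum_i a i * b i) + 4 * \sum_i b i ^+ 2.
  rewrite !mulr_sumr -!big_split/=; apply: eq_bigr => i _.
  have -> : \sum_j 2 * a j * H i j = 2 * b i.
    by rewrite mulr_sumr; apply: eq_bigr => j _; rewrite mulrA.
  by ring.
(* |G| <= K |grad W|, and |grad W| <= z p + 2 p d because grad W = z a + 2 H a with |a| = p and |H
   a| <= p d. *)
have aG : \sum_i a i * G i <= p * (K * (z * p + 2 * (p * d))).
  apply: dot_le; rewrite -?wE//.
    by rewrite mulr_ge0 ?addr_ge0 ?mulr_ge0.
  rewrite exprMn (le_trans GK)// ler_wpM2l ?sqr_ge0// vE.
  have := ler_wpM2l z0 ab; rewrite wE SE in bS *; lra.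
have zF := ler_wpM2l z0 FK.
have Kzz : 0 <= K * (z * z) by rewrite !mulr_ge0.
have Kzw : 0 <= K * (z * w) by rewrite !mulr_ge0.
have Kww : 0 <= K * (w * w) by rewrite !mulr_ge0.
have KKz : 0 <= K * K * z by rewrite !mulr_ge0.
have KKw : 0 <= K * K * w by rewrite !mulr_ge0.
have Kz : 0 <= K * z by rewrite !mulr_ge0.
have Kw : 0 <= K * w by rewrite !mulr_ge0.
have KKzz : 0 <= K * K * (z * z) by rewrite !mulr_ge0.
have KKzw : 0 <= K * K * (z * w) by rewrite !mulr_ge0.
have zw : 0 <= z * w by rewrite mulr_ge0.
(* d stands for |D^2 u| and w for |grad u|^2; the square absorbs the cross term
   4 K w d into the good term - 2 d^2. *)
have sq : 0 <= (d - K * w) ^+ 2 by exact: sqr_ge0.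
have aG' : \sum_i a i * G i <= K * (z * w) + 2 * K * w * d.
  apply: le_trans aG _; rewrite wE le_eqVlt; apply/orP; left; apply/eqP.
  by ring.
rewrite SE; lra.
Qed.

Lemma is_derive_mulf (R : realType) (V : normedModType R) (f g : V -> R)
    (x v : V) (a b : R) : is_derive x v f a -> is_derive x v g b ->
  is_derive x v (fun y => f y * g y) (f x * b + a * g x).
Proof.
by move=> fa gb; apply: (is_derive_eq (is_deriveM fa gb)); rewrite [a * _]mulrC.
Qed.

Lemma is_derive_cstM (R : realType) (V : normedModType R) (f : V -> R)
    (x v : V) (c a : R) :
  is_derive x v f a -> is_derive x v (fun y => c * f y) (c * a).
Proof. by move=> fa; exact: (is_deriveZ c fa). Qed.

(** Bochner's identity for W with the derivatives of u as free symbols: [A i] is the i-th pure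
    second derivative, [D j] is the j-th derivative of [dtau u], and [T i j] is the second
    derivative in direction i of the j-th partial. *)
Lemma bernstein_identity (R : realType) (n : nat) (z dt : R)
    (a A D : 'I_n -> R) (H T : 'I_n -> 'I_n -> R) :
  z * dt + \sum_j 2 * a j * D j
  - \sum_i (z * a i ^+ 2 + z * A i
            + \sum_j (2 * H i j ^+ 2 + 2 * a j * T i j)) =
  z * (dt - \sum_i A i) - z * (\sum_i a i ^+ 2)
  + 2 * \sum_j a j * (D j - \sum_i T i j) - 2 * \sum_i \sum_j H i j ^+ 2.
Proof.
have -> : \sum_i (z * a i ^+ 2 + z * A i
      + \sum_j (2 * H i j ^+ 2 + 2 * a j * T i j)) =
    z * (\sum_i a i ^+ 2) + z * (\sum_i A i)
    + (2 * (\sum_i \sum_j H i j ^+ 2) + 2 * \sum_j a j * \sum_i T i j).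
  rewrite !big_split/= -!mulr_sumr; congr (_ + _).
  rewrite -mulrDr (eq_bigr (fun i => 2 * \sum_j H i j ^+ 2
      + 2 * \sum_j a j * T i j)); last first.
    move=> i _; rewrite big_split/= !mulr_sumr; congr (_ + _).
    by apply: eq_bigr => j _; rewrite mulrA.
  rewrite big_split/= -!mulr_sumr mulrDr; congr (_ + 2 * _).
  by rewrite exchange_big; apply: eq_bigr => j _; rewrite mulr_sumr.
have -> : \sum_j 2 * a j * D j = 2 * \sum_j a j * D j.
  by rewrite mulr_sumr; apply: eq_bigr => j _; rewrite mulrA.
have -> : \sum_j a j * (D j - \sum_i T i j) =
    \sum_j a j * D j - \sum_j a j * \sum_i T i j.
  by rewrite -sumrB; apply: eq_bigr => j _; rewrite mulrBr.
by ring.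
Qed.

Lemma is_derive_addf (R : realType) (V : normedModType R) (f g : V -> R)
    (x v : V) (a b : R) : is_derive x v f a -> is_derive x v g b ->
  is_derive x v (fun y => f y + g y) (a + b).
Proof. exact: is_deriveD. Qed.

Lemma is_derive_subf (R : realType) (V : normedModType R) (f g : V -> R)
    (x v : V) (a b : R) : is_derive x v f a -> is_derive x v g b ->
  is_derive x v (fun y => f y - g y) (a - b).
Proof. exact: is_deriveB. Qed.

Lemma is_derive_constf (R : realType) (V : normedModType R) (c : R) (x v : V) :
  is_derive x v (fun=> c) 0.
Proof. exact: is_derive_cst. Qed.

Lemma is_derive_idf (R : realType) (x : R) : is_derive x 1 (fun y => y) 1.
Proof. exact: is_derive_id. Qed.

Lemma is_derive_bigsum (R : realType) (n : nat) (V : normedModType R)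
    (f : 'I_n -> V -> R) (x v : V) (d : 'I_n -> R) :
  (forall j, is_derive x v (f j) (d j)) ->
  is_derive x v (fun y => \sum_j f j y) (\sum_j d j).
Proof. by move=> fd; have := is_derive_sum fd; rewrite fct_sumE. Qed.

(** * The energy W and its differential inequality *)

Section energy.
Context (R : realType) (N : nat) (u : 'rV[R]_N -> R -> R).
Implicit Types (x : 'rV[R]_N) (t : R) (i j : 'I_N).

Definition energy x t : R := expR (u x t) + \sum_j dx j u x t ^+ 2.

Definition dx_energy i x t : R :=
  expR (u x t) * dx i u x t + \sum_j 2 * dx j u x t * dx i (dx j u) x t.

Definition dxx_energy i x t : R :=
  expR (u x t) * dx i u x t ^+ 2 + expR (u x t) * dx i (dx i u) x t
  + \sum_j (2 * dx i (dx j u) x t ^+ 2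
            + 2 * dx j u x t * dx i (dx i (dx j u)) x t).

(** The mixed derivative is written with the spatial one outermost, the order that
    [classically_regular] supplies. *)
Definition dt_energy x t : R :=
  expR (u x t) * dtau u x t + \sum_j 2 * dx j u x t * dx j (dtau u) x t.

Lemma sqr_enorm_grad x t :
  enorm (grad (u ^~ t) x) ^+ 2 = \sum_j dx j u x t ^+ 2.
Proof. by rewrite sqr_enorm; apply: eq_bigr => j _; rewrite mxE. Qed.

Lemma energyE t :
  (fun y => expR (u y t) + enorm (grad (u ^~ t) y) ^+ 2) = energy ^~ t.
Proof. by apply/funext => y; rewrite sqr_enorm_grad. Qed.

Lemma is_derive_energy i x t : Cspace 2 u -> enorm x < 1 -> 0 <= t < 1 ->
  is_derive x (delta_mx 0 i) (energy ^~ t) (dx_energy i x t).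
Proof.
move=> uC x1 t01.
apply: is_deriveD.
  apply: (@is_derive_comp1 _ _ expR (u ^~ t)).
  exact: (Cspace_derivable i (Cspace_le (leqnSn 1) uC) x1 t01).
apply: is_derive_bigsum => j.
have := is_deriveX 2 (Cspace_derivable i (Cspace_dx j uC) x1 t01).
by rewrite expr1.
Qed.

Lemma is_derive_dx_energy i x t : Cspace 3 u -> enorm x < 1 -> 0 <= t < 1 ->
  is_derive x (delta_mx 0 i) (dx_energy i ^~ t) (dxx_energy i x t).
Proof.
move=> uC x1 t01.
have d1 j := Cspace_derivable i (Cspace_le (leqnSn 1) (Cspace_dx j uC)) x1 t01.
have d2 j := Cspace_derivable i (Cspace_dx i (Cspace_dx j uC)) x1 t01.
have d0 := Cspace_derivable i (Cspace_le (isT : 1 <= 3)%N uC) x1 t01.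
have de : is_derive x (delta_mx 0 i) (fun y => expR (u y t))
    (expR (u x t) * dx i u x t) by exact: (@is_derive_comp1 _ _ expR (u ^~ t)).
apply: is_deriveD.
  apply: (is_derive_eq (is_derive_mulf de (d1 i))).
  by move: (dx i u x t) (dx i (dx i u) x t) => a b; ring.
apply: is_derive_bigsum => j.
apply: (is_derive_eq (is_derive_mulf (is_derive_cstM 2 (d1 j)) (d2 j))).
move: (dx j u x t) (dx i (dx j u) x t) (dx i (dx i (dx j u)) x t) => a b c.
by ring.
Qed.

Lemma is_derive_energy_t x t : classically_regular u -> enorm x < 1 ->
  0 < t < 1 -> is_derive t 1 (energy x) (dt_energy x t).
Proof.
move=> [uC ud tC] x1 t01.
have xt : cylinder (x, t) by exact: interior_subset (cylinder_interior x1 t01).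
apply: is_deriveD.
  apply: (@is_derive_comp1 _ _ expR (u x)).
  exact: is_derive_dtau (ud _ _ xt) x1 t01.
apply: is_derive_bigsum => j.
have uC1 := Cspace_le (isT : 1 <= 3)%N uC.
have := is_deriveX 2 (is_derive_dx_dtau j ud uC1 tC x1 t01).
by rewrite expr1.
Qed.

(** The identity turns the left side into the expression bounded by [bernstein_algebra].
    Differentiating the heat operator puts the new derivative outermost, whereas the energy has it
    innermost; the two agree by symmetry of third derivatives, which holds as t > 0. *)
Lemma bernstein K x t : 0 < K -> classically_regular u -> enorm x < 1 ->
  0 < t < 1 ->
  `|heat_op u x t| <= K * (1 + expR (u x t) + enorm (grad (u ^~ t) x) ^+ 2) ->
  enorm (grad (heat_op u ^~ t) x)
    <= K * enorm (grad (fun y => expR (u y t)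
                                 + enorm (grad (u ^~ t) y) ^+ 2) x) ->
  dt_energy x t - \sum_i dxx_energy i x t
    <= (2 * K + 2 * K ^+ 2) * (energy x t + energy x t ^+ 2).
Proof.
move=> K0 [uC ud tC] x1 t01.
have t01' : 0 <= t < 1 by case/andP: t01 => /ltW -> ->.
rewrite sqr_enorm_grad energyE => heat gheat.
pose G j := dx j (dtau u) x t - \sum_i dx j (dx i (dx i u)) x t.
have GE j : (grad (heat_op u ^~ t) x) 0 j = G j.
  rewrite mxE.
  have d := is_deriveB (Cspace_derivable j tC x1 t01')
    (is_derive_bigsum (fun i =>
      Cspace_derivable j (Cspace_dx i (Cspace_dx i uC)) x1 t01')).
  by case: d => _ dE; rewrite /G -dE.
have EE j : (grad (energy ^~ t) x) 0 j = dx_energy j x t.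
  rewrite mxE.
  by case: (is_derive_energy j (Cspace_le (leqnSn 2) uC) x1 t01') => _ <-.
have B := @bernstein_algebra R N K (expR (u x t)) (heat_op u x t)
  (fun j => dx j u x t) G (fun i j => dx i (dx j u) x t) (ltW K0) (expR_ge0 _)
  (le_trans (ler_norm _) heat).
have GG : \sum_i G i ^+ 2 <= K ^+ 2 * \sum_i dx_energy i x t ^+ 2.
  under eq_bigr do rewrite -GE; under [in leRHS]eq_bigr do rewrite -EE.
  rewrite -!sqr_enorm -exprMn ler_pXn2r// nnegrE ?enorm_ge0//.
  by rewrite mulr_ge0 ?enorm_ge0// ltW.
apply: le_trans (B GG); rewrite le_eqVlt; apply/orP; left; apply/eqP.
rewrite [LHS](@bernstein_identity R N (expR (u x t)) (dtau u x t)
  (fun j => dx j u x t) (fun j => dx j (dx j u) x t)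
  (fun j => dx j (dtau u) x t) (fun i j => dx i (dx j u) x t)
  (fun i j => dx i (dx i (dx j u)) x t)).
have -> : heat_op u x t = dtau u x t - \sum_j dx j (dx j u) x t by [].
suff GT j : G j = dx j (dtau u) x t - \sum_i dx i (dx i (dx j u)) x t.
  by rewrite (funext GT).
(* A rewrite would try to unify the two iterated derivatives by unfolding. *)
have TE : \sum_i dx j (dx i (dx i u)) x t = \sum_i dx i (dx i (dx j u)) x t.
  by apply: eq_bigr => i _; exact: Cspace_dxxC uC x1 t01.
exact: (congr1 (fun s => dx j (dtau u) x t - s) TE).
Qed.
End energy.

(** * The barrier and its contact points *)

(** Here B = 1/2 - |x|^2, and [W1], [W2], [Wt] are the derivatives of W where W g e^(-C t) touches
    its maximum. The spatial conditions give g Laplacian(W) <= W / 2, the time condition gives g Wt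
    >= W + C W g, and the heat inequality then leaves W / 2 <= C W^2 g. *)
Lemma contact_algebra (R : realType) (n : nat) (C b B g W Wt : R)
    (x W1 W2 : 'I_n -> R) :
  0 < W -> 0 < g -> 0 < b -> 0 <= B -> B = 2^-1 - \sum_i x i ^+ 2 ->
  b * B ^+ 2 <= g -> b * (4 * (n%:R + 8)) = 1 ->
  (forall i, W1 i * g + W * (- (4 * b) * (B * x i)) = 0) ->
  (forall i, W2 i * g + 2 * (W1 i * (- (4 * b) * (B * x i)))
             + W * (- (4 * b) * (B - 2 * x i ^+ 2)) <= 0) ->
  0 <= Wt * g - W - C * W * g ->
  Wt - \sum_i W2 i <= C * (W + W ^+ 2) ->
  2^-1 <= C * (W * g).
Proof.
move=> W0 g0 b0 B0 BE bB bn W1E W2E WtE heat.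
set r2 := \sum_i x i ^+ 2 in BE.
have r0 : 0 <= r2 by apply: sumr_ge0 => i _; exact: sqr_ge0.
(* The first-order condition eliminates [W1], once the second-order one has been multiplied by g. *)
have {}W2E i : g ^+ 2 * W2 i <= W * (32 * b ^+ 2 * B ^+ 2 * x i ^+ 2)
    + W * g * (4 * b * B) - W * g * (8 * b * x i ^+ 2).
  have W1i : W1 i * g = W * (4 * b * (B * x i)) by have := W1E i; lra.
  have := ler_wpM2l (ltW g0) (W2E i).
  rewrite mulr0 (_ : g * _ = g ^+ 2 * W2 i
    + 2 * (W1 i * g * (- (4 * b) * (B * x i)))
    + W * g * (- (4 * b) * (B - 2 * x i ^+ 2))); last by ring.
  by rewrite W1i; lra.
have {}W2E : g ^+ 2 * \sum_i W2 i <= W * (32 * b ^+ 2 * B ^+ 2 * r2)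
    + W * g * (4 * b * B) * n%:R - W * g * (8 * b * r2).
  rewrite mulr_sumr; apply: le_trans (ler_sum _ (fun i _ => W2E i)) _.
  rewrite sumrB big_split/= sumr_const card_ord -!mulr_sumr -/r2.
  by rewrite mulr_natr.
have bBr : b ^+ 2 * B ^+ 2 * r2 <= b * g * 2^-1.
  have -> : b ^+ 2 * B ^+ 2 * r2 = b * (b * B ^+ 2 * r2) by ring.
  rewrite -(mulrA b g) ler_pM2l//; apply: ler_pM => //; last by lra.
  by rewrite mulr_ge0 ?sqr_ge0 ?(ltW b0).
have n0 : 0 <= n%:R :> R by exact: ler0n.
have bn0 : 0 <= b * n%:R by rewrite mulr_ge0 ?(ltW b0).
have bBn : b * B * n%:R <= b * n%:R * 2^-1.
  by rewrite mulrAC; apply: ler_wpM2l => //; lra.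
have Wg : 0 < W * g by rewrite mulr_gt0.
(* The bounds b B^2 <= g, B <= 1/2 and |x|^2 <= 1/2 leave the error b (16 + 2 n) W g, which the
   choice b = 1 / (4 (n + 8)) makes exactly W g / 2. *)
have main : g * (g * \sum_i W2 i) <= g * (W * 2^-1).
  rewrite mulrA -expr2; apply: le_trans W2E _.
  have e1 := ler_wpM2l (ltW W0) bBr.
  have e2 := ler_wpM2l (ltW Wg) bBn.
  have e3 : 0 <= W * g * (b * r2) by rewrite mulr_ge0 ?(ltW Wg) ?mulr_ge0 ?(ltW b0).
  have e4 : W * g * (b * (4 * (n%:R + 8))) = W * g by rewrite bn mulr1.
  by move: e1 e2 e3 e4; lra.
rewrite ler_pM2l// in main.
have h1 := ler_wpM2l (ltW g0) heat.
have : W * 2^-1 <= W * (C * (W * g)) by move: main h1 WtE; lra.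
by rewrite ler_pM2l.
Qed.

(** One-sided, because a first contact compares only with earlier times. *)
Lemma is_derive_left_max (R : realType) (f : R -> R) (a d : R) :
  is_derive a 1 f d -> (\forall s \near a, s < a -> f s <= f a) -> 0 <= d.
Proof.
move=> /cvg_is_derive fd /nbhs_ballP[e/= e0 fmax].
rewrite leNgt; apply/negP => d0.
have : \forall h \near (0 : R)^', h^-1 * (f (h + a) - f a) < 0.
  exact: (cvgr_lt (F := (0 : R)^') _ fd).
rewrite /dnbhs near_withinE => /nbhs_ballP[r/= r0 fr].
have [h [h0 he hr]] : exists h, [/\ 0 < h, h < e & h < r].
  have m0 : 0 < Num.min e r by rewrite lt_min e0.
  exists (Num.min e r / 2).
  have mr : Num.min e r / 2 < Num.min e r by lra.
  by move: (mr); rewrite divr_gt0// lt_min => /andP[-> ->].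
have fh : f (- h + a) <= f a.
  apply: fmax; last by lra.
  by rewrite /ball/= opprD opprK addrCA subrr addr0 gtr0_norm.
have hN0 : - h != 0 by rewrite oppr_eq0 gt_eqF.
have := fr (- h); rewrite /ball/= sub0r opprK gtr0_norm// => /(_ hr hN0).
by rewrite invrN mulNr oppr_lt0 pmulr_rgt0 ?invr_gt0// subr_gt0 ltNge fh.
Qed.

Lemma is_derive_coord (R : realType) (N : nat) (i j : 'I_N) (x : 'rV[R]_N) :
  is_derive x (delta_mx 0 i) (fun y : 'rV[R]_N => y 0 j) (j == i)%:R.
Proof.
apply: is_derive_of_line.
have -> : (fun s : R => (x + s *: delta_mx 0 i) 0 j) =
    (fun s => x 0 j + (j == i)%:R * s).
  by apply/funext => s; rewrite !mxE eqxx/= mulrC.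
have d := is_derive_addf (is_derive_constf (x 0 j) (0 : R) 1)
  (is_derive_cstM (j == i)%:R (is_derive_idf (0 : R))).
by apply: (is_derive_eq d); rewrite add0r mulr1.
Qed.

Lemma is_derive_sqnorm (R : realType) (N : nat) (i : 'I_N) (x : 'rV[R]_N) :
  is_derive x (delta_mx 0 i) (fun y : 'rV[R]_N => \sum_j y 0 j ^+ 2)
    (2 * x 0 i).
Proof.
have d := is_derive_bigsum (fun j => is_derive_mulf (is_derive_coord i j x)
  (is_derive_coord i j x)).
apply: (is_derive_eq d); rewrite (bigD1 i)//= eqxx big1 => [|j /negPf ->].
  by rewrite mulr1 mul1r addr0 mulr_natl mulr2n.
by rewrite mulr0 mul0r addr0.
Qed.

Definition barrier (R : realType) (N : nat) (b : R) (x : 'rV[R]_N) (t : R) :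
  R := 1 - t + b * (2^-1 - \sum_j x 0 j ^+ 2) ^+ 2.

Section contact.
Context (R : realType) (N : nat) (b : R).
Implicit Types (x : 'rV[R]_N) (t : R) (i : 'I_N).

Lemma is_derive_gap i x :
  is_derive x (delta_mx 0 i) (fun y : 'rV[R]_N => 2^-1 - \sum_j y 0 j ^+ 2)
    (- (2 * x 0 i)).
Proof.
have d := is_derive_subf (is_derive_constf 2^-1 x _) (is_derive_sqnorm i x).
by apply: (is_derive_eq d); rewrite sub0r.
Qed.

Lemma is_derive_barrier i x t :
  is_derive x (delta_mx 0 i) (barrier b ^~ t)
    (- (4 * b) * ((2^-1 - \sum_j x 0 j ^+ 2) * x 0 i)).
Proof.
have d := is_derive_addf (is_derive_constf (1 - t) x _) (is_derive_cstM b
  (is_derive_mulf (is_derive_gap i x) (is_derive_gap i x))).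
by apply: (is_derive_eq d); ring.
Qed.

Lemma is_derive_dx_barrier i x :
  is_derive x (delta_mx 0 i)
    (fun y : 'rV[R]_N => - (4 * b) * ((2^-1 - \sum_j y 0 j ^+ 2) * y 0 i))
    (- (4 * b) * (2^-1 - \sum_j x 0 j ^+ 2 - 2 * x 0 i ^+ 2)).
Proof.
have d := is_derive_cstM (- (4 * b)) (is_derive_mulf (is_derive_gap i x)
  (is_derive_coord i i x)).
by apply: (is_derive_eq d); rewrite eqxx mulr1n; ring.
Qed.

Lemma is_derive_barrier_t x t : is_derive t 1 (barrier b x) (-1).
Proof.
have d := is_derive_addf
  (is_derive_subf (is_derive_constf 1 t _) (is_derive_idf t))
  (is_derive_constf (b * (2^-1 - \sum_j x 0 j ^+ 2) ^+ 2) t _).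
by apply: (is_derive_eq d); ring.
Qed.

Lemma barrier_gt0 x t : 0 < b -> t < 1 -> 0 < barrier b x t.
Proof.
move=> b0 t1; have : 0 <= b * (2^-1 - \sum_j x 0 j ^+ 2) ^+ 2.
  by rewrite mulr_ge0 ?sqr_ge0 ?(ltW b0).
by rewrite /barrier; lra.
Qed.

Lemma energy_gt0 (u : 'rV[R]_N -> R -> R) x t : 0 < energy u x t.
Proof.
apply: ltr_pwDl; first exact: expR_gt0.
by apply: sumr_ge0 => i _; exact: sqr_ge0.
Qed.

(** The second derivative test on each coordinate line and the left maximum in time supply the
    hypotheses of [contact_algebra]. At fixed t the exponential is a constant factor and is left out
    of the spatial comparison. *)
Lemma contact (u : 'rV[R]_N -> R -> R) (C : R) x t :
  classically_regular u -> 0 < b -> b * (4 * (N%:R + 8)) = 1 ->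
  \sum_j x 0 j ^+ 2 < 2^-1 -> 0 < t < 1 ->
  dt_energy u x t - \sum_i dxx_energy u i x t
    <= C * (energy u x t + energy u x t ^+ 2) ->
  (\forall y \near x, energy u y t * barrier b y t
                      <= energy u x t * barrier b x t) ->
  (\forall s \near t, s < t ->
     energy u x s * barrier b x s * expR (- C * s)
       <= energy u x t * barrier b x t * expR (- C * t)) ->
  2^-1 <= C * (energy u x t * barrier b x t).
Proof.
move=> ureg b0 bN x2 t01 heat xmax tmax.
have [uC _ _] := ureg; have uC2 := Cspace_le (leqnSn 2) uC.
have x1 : enorm x < 1.
  by rewrite -(@ltr_pXn2r _ 2%N)// ?nnegrE ?enorm_ge0// sqr_enorm expr1n; lra.
have t01' : 0 <= t < 1 by case/andP: t01 => /ltW -> ->.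
have W0 := energy_gt0 u x t.
have g0 : 0 < barrier b x t by apply: barrier_gt0 => //; case/andP: t01.
have dE : is_derive t 1 (fun s => expR (- C * s)) (expR (- C * t) * (- C * 1)).
  have d := is_derive_cstM (- C) (is_derive_idf t).
  exact: (is_derive_comp1 (is_derive_expR (- C * t)) d).
have dt := is_derive_mulf (is_derive_mulf (is_derive_energy_t ureg x1 t01)
  (is_derive_barrier_t x t)) dE.
have dt0 := is_derive_left_max dt tmax.
have space i : dx_energy u i x t * barrier b x t + energy u x t *
      (- (4 * b) * ((2^-1 - \sum_j x 0 j ^+ 2) * x 0 i)) = 0 /\
    dxx_energy u i x t * barrier b x t + 2 * (dx_energy u i x t *
      (- (4 * b) * ((2^-1 - \sum_j x 0 j ^+ 2) * x 0 i))) + energy u x t *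
      (- (4 * b) * (2^-1 - \sum_j x 0 j ^+ 2 - 2 * x 0 i ^+ 2)) <= 0.
  pose ei : 'rV[R]_N := delta_mx 0 i.
  pose f y := energy u y t * barrier b y t.
  pose f1 y := energy u y t *
      (- (4 * b) * ((2^-1 - \sum_j y 0 j ^+ 2) * y 0 i))
    + dx_energy u i y t * barrier b y t.
  have near_line (P : 'rV[R]_N -> Prop) : (\forall y \near x, P y) ->
      \forall s \near (0 : R), P (x + s *: ei).
    have c : {for 0, continuous (fun s : R => x + s *: ei)}.
      by apply: cvgD; [exact: cvg_cst|apply: cvgZr_tmp; exact: cvg_id].
    by move=> xP; apply: c; rewrite scale0r addr0.
  have d1 : \forall s \near (0 : R),
      is_derive (s : R) 1 (fun s => f (x + s *: ei)) (f1 (x + s *: ei)).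
    apply: filterS (near_line _ (near_enorm_lt x1)) => s y1.
    apply: (@is_derive_line _ _ f x ei).
    exact: (is_derive_mulf (is_derive_energy i uC2 y1 t01')
      (is_derive_barrier i _ t)).
  have d2 := is_derive_mulf (is_derive_energy i uC2 x1 t01')
    (is_derive_dx_barrier i x).
  have d3 := is_derive_mulf (is_derive_dx_energy i uC x1 t01')
      (is_derive_barrier i x t).
  have d4 := is_derive_addf d2 d3.
  move: d4; rewrite -[X in is_derive X]addr0 -(scale0r ei).
  move=> /(@is_derive_line _ _ f1 x ei) d5.
  have fmax : \forall s \near (0 : R), f (x + s *: ei) <= f (x + 0 *: ei).
    by rewrite scale0r addr0; exact: (near_line _ xmax).
  have [] := second_derivative_test d1 d5 fmax.
  rewrite scale0r addr0 /f1 => e1 f2; split; first by rewrite addrC.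
  apply: le_trans f2; rewrite le_eqVlt; apply/orP; left; apply/eqP.
  move: (dx_energy u i x t) (dxx_energy u i x t) (energy u x t) (barrier b x t).
  by move=> *; ring.
apply: (@contact_algebra R N C b (2^-1 - \sum_j x 0 j ^+ 2) (barrier b x t)
  (energy u x t) (dt_energy u x t) (fun j => x 0 j) (fun i => dx_energy u i x t)
  (fun i => dxx_energy u i x t)) => //.
- by rewrite subr_ge0 ltW.
- by rewrite /barrier lerDr subr_ge0; case/andP: t01 => _ /ltW.
- by move=> i; have [] := space i.
- by move=> i; have [] := space i.
have E0 := expR_gt0 (- C * t).
(* The time derivative of W g e^(-C t) is e^(-C t) (Wt g - W - C W g); the positive factor is
   cancelled. *)
rewrite -(pmulr_lge0 _ E0); apply: le_trans dt0 _.
rewrite le_eqVlt; apply/orP; left; apply/eqP.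
move: (dt_energy u x t) (energy u x t) (barrier b x t) (expR _).
by move=> *; ring.
Qed.
End contact.

(** * First contact time and comparison *)

(** The part of A where Q >= d is compact and nonempty, so [tau] attains its minimum there. *)
Lemma first_touch (R : realType) (T : topologicalType) (A : set T)
    (Q tau : T -> R) (d : R) :
  compact A -> {within A, continuous Q} -> continuous tau ->
  (exists2 p, A p & d <= Q p) ->
  exists p, [/\ A p, d <= Q p & forall q, A q -> tau q < tau p -> Q q < d].
Proof.
move=> cA cQ ctau [p0 Ap0 Qp0].
(* Q is continuous only within A, so its superlevel set is closed only relative to A; V is a closed
   set with the same trace on A. *)
have /closed_subspaceP[V cV VA] :
    closed ([set p | d <= Q p] : set (subspace A)).
  by move/continuous_closedP : cQ => /(_ _ (@closed_ge _ d)).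
have VE q : A q -> V q <-> d <= Q q.
  move=> Aq; have : (V `&` A) q = ([set p | d <= Q p] `&` A) q by rewrite VA.
  by move=> E; split=> Vq; [have : (V `&` A) q by []; rewrite E => -[]|
    have : ([set p | d <= Q p] `&` A) q by []; rewrite -E => -[]].
have AV0 : A `&` V !=set0 by exists p0; split=> //; exact/VE.
have [p] := compact_EVT_min AV0 (compact_closedI cA cV)
  (continuous_subspaceT ctau).
rewrite inE => -[Ap Vp] pmin; exists p; split=> //; first exact/VE.
move=> q Aq; rewrite ltNge [Q q < d]ltNge => /negP qp; apply/negP => dq.
by apply: qp; apply: pmin; rewrite inE; split=> //; exact/VE.
Qed.

Lemma continuous_sqnorm (R : realType) (N : nat) :
  continuous (fun x : 'rV[R]_N => \sum_j x 0 j ^+ 2).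
Proof.
move=> x; apply: (cvg_bigsum (F := nbhs x)) => i.
by apply: cvgM; exact: coord_continuous.
Qed.

Lemma compact_sqnorm_le (R : realType) (N : nat) (r : R) : r <= 1 ->
  compact [set x : 'rV[R]_N | \sum_j x 0 j ^+ 2 <= r].
Proof.
move=> r1; apply: (@subclosed_compact _ _ [set v : 'rV[R]_N |
    forall i, `[(-1), 1]%classic (v ord0 i)]).
- have /continuous_closedP := @continuous_sqnorm R N.
  by move=> /(_ _ (@closed_le _ r)).
- have := @rV_compact R N (fun=> `[(-1), 1]%classic).
  by apply=> i; exact: segment_compact.
move=> x /= xr i; rewrite /= in_itv/= -ler_norml.
rewrite -(@ler_pXn2r _ 2%N)// ?nnegrE// expr1n real_normK ?num_real//.
apply: le_trans r1; apply: le_trans xr; rewrite (bigD1 i)//= lerDl.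
by apply: sumr_ge0 => j _; exact: sqr_ge0.
Qed.

Lemma continuous_energy_barrier (R : realType) (N : nat) (C b : R)
    (u : 'rV[R]_N -> R -> R) : Cspace 1 u ->
  {within @cylinder R N, continuous (fun p =>
    energy u p.1 p.2 * barrier b p.1 p.2 * expR (- C * p.2))}.
Proof.
move=> uC.
apply/subspace_continuousP => p cp.
set F := within _ _.
have c1 : p.1 @[p --> F] --> p.1 by apply: cvg_within_filter; exact: cvg_fst.
have c2 : p.2 @[p --> F] --> p.2 by apply: cvg_within_filter; exact: cvg_snd.
have cu k f : Cspace k f -> f p.1 p.2 @[p --> F] --> f p.1 p.2.
  by move=> /Cspace_continuous/subspace_continuousP; exact.
apply: cvgM; [apply: cvgM|].
- apply: cvgD.
    exact: (continuous_cvg (h := expR) _ (@continuous_expR R _) (cu _ _ uC)).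
  apply: (cvg_bigsum (F := F)) => j.
  by apply: cvgM; exact: (cu _ _ (Cspace_dx j uC)).
- apply: cvgD; first by apply: cvgB => //; exact: cvg_cst.
  apply: cvgMl_tmp.
  have c3 : (fun p : 'rV[R]_N * R => 2^-1 - \sum_j p.1 0 j ^+ 2) @ F -->
      2^-1 - \sum_j p.1 0 j ^+ 2.
    apply: cvgB; first exact: cvg_cst.
    exact: (continuous_cvg (h := fun x : 'rV[R]_N => \sum_j x 0 j ^+ 2) _
      (@continuous_sqnorm R N _) c1).
  exact: (cvgM c3 c3).
- exact: (continuous_cvg (h := expR) _ (@continuous_expR R _)
    (cvgMl_tmp (a := - C) c2)).
Qed.

(** By contradiction at the first contact: smallness excludes t = 0 and the sphere |x|^2 = 1/2, and
    an interior contact contradicts [contact] by the choice of d. *)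
Lemma energy_barrier_lt (R : realType) (N : nat) (u : 'rV[R]_N -> R -> R)
    (K C b d eps : R) :
  C = 2 * K + 2 * K ^+ 2 -> b = (4 * (N%:R + 8))^-1 ->
  d = expR (- C) / (4 * C) -> 0 < K -> classically_regular u ->
  eps <= 1 -> 4 * eps < d ->
  (forall (x : 'rV[R]_N) (t : R), enorm x < 1 -> 0 <= t < 1 ->
    `|heat_op u x t|
      <= K * (1 + expR (u x t) + enorm (grad (u ^~ t) x) ^+ 2)) ->
  (forall (x : 'rV[R]_N) (t : R), enorm x < 1 -> 0 <= t < 1 ->
    enorm (grad (heat_op u ^~ t) x)
      <= K * enorm (grad (fun y => expR (u y t)
                                   + enorm (grad (u ^~ t) y) ^+ 2) x)) ->
  (forall (x : 'rV[R]_N) (t : R), enorm x < 1 -> 0 <= t < 1 ->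
    (1 - t) * expR (u x t) + Num.sqrt (1 - t) * enorm (grad (u ^~ t) x)
      <= eps) ->
  forall (x : 'rV[R]_N) (t : R), \sum_j x 0 j ^+ 2 <= 2^-1 -> 0 <= t < 1 ->
    energy u x t * barrier b x t * expR (- C * t) < d.
Proof.
move=> CE bE dE0 K0 ureg eps1 epsd H1 H2 H3 x1 t1 x1A /andP[t10 t11].
rewrite ltNge; apply/negP => Q1.
pose Q (x : 'rV[R]_N) (t : R) :=
  energy u x t * barrier b x t * expR (- C * t).
have cQ : {within @cylinder R N, continuous (fun p => Q p.1 p.2)}.
  by apply: continuous_energy_barrier; have [uC _ _] := ureg;
    exact: Cspace_le uC.
have C0 : 0 < C by rewrite CE addr_gt0// mulr_gt0// exprn_gt0.
have N0 : 0 <= N%:R :> R by exact: ler0n.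
have b0 : 0 < b by rewrite bE invr_gt0; lra.
have bN : b * (4 * (N%:R + 8)) = 1 by rewrite bE mulVf//; lra.
have b1 : b <= 1 by rewrite bE invf_le1; lra.
have ball1 (x : 'rV[R]_N) : \sum_j x 0 j ^+ 2 <= 2^-1 -> enorm x < 1.
  move=> xA; rewrite -(@ltr_pXn2r _ 2%N)// ?nnegrE ?enorm_ge0//.
  by rewrite sqr_enorm expr1n; lra.
have smallE (x : 'rV[R]_N) (t : R) : \sum_j x 0 j ^+ 2 <= 2^-1 -> 0 <= t < 1 ->
    (1 - t) * energy u x t <= 2 * eps.
  move=> /ball1 xb t01; have H := H3 _ _ xb t01; case/andP: t01 => t0 t1'.
  rewrite /energy -sqr_enorm_grad mulrDr.
  have s0 : 0 <= 1 - t by lra.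
  rewrite -{2}(sqr_sqrtr s0) -exprMn.
  have : 0 <= (1 - t) * expR (u x t) by rewrite mulr_ge0 ?expR_ge0.
  have : 0 <= Num.sqrt (1 - t) * enorm (grad (u ^~ t) x).
    by rewrite mulr_ge0 ?enorm_ge0 ?sqrtr_ge0.
  move: H; move: (_ * enorm _) (_ * expR _) => p q pq p0 q0.
  (* (1 - t) W = p^2 + q with p + q <= eps, and eps <= 1 allows p^2 to be replaced by p. *)
  have : p ^+ 2 <= p by rewrite expr2 ler_piMr//; lra.
  by lra.
(* Stopping at [t1] < 1, the time of the supposed violation, makes the region a compact part of the
   cylinder. *)
pose A := [set x : 'rV[R]_N | \sum_j x 0 j ^+ 2 <= 2^-1] `*` `[0, t1]%classic.
have cA : compact A.
  apply: compact_setX; last exact: segment_compact.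
  by apply: compact_sqnorm_le; lra.
have Acyl : A `<=` @cylinder R N.
  move=> [x t] [/= /ball1 xA]; rewrite in_itv/= => /andP[t0 tt1]; split=> //=.
  by rewrite t0 (le_lt_trans tt1).
have [] := @first_touch R _ A (fun p => Q p.1 p.2) snd d cA.
- exact: continuous_subspaceW cQ.
- by move=> p; exact: cvg_snd.
- by exists (x1, t1) => //; split=> //=; rewrite in_itv/= lexx t10.
move=> [x t] [[/= xA]]; rewrite in_itv/= => /andP[t0 tt1] Qd Qlt.
have t1' : t < 1 by exact: le_lt_trans tt1 t11.
have t01' : 0 <= t < 1 by rewrite t0.
have {}Qlt (y : 'rV[R]_N) (s : R) :
    \sum_j y 0 j ^+ 2 <= 2^-1 -> 0 <= s -> s < t -> Q y s < d.
  move=> yA s0 st; apply: (Qlt (y, s)) => //; split=> //=.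
  by rewrite in_itv/= s0 (le_trans (ltW st)).
have W0 := energy_gt0 u x t.
have dEt : expR (- C * t) <= 1.
  by rewrite -expR0 ler_expR mulNr oppr_le0 mulr_ge0// ltW.
have Qle g : 0 <= g -> barrier b x t <= g -> Q x t <= energy u x t * g.
  move=> g0 bg; rewrite /Q -[leRHS]mulr1; apply: ler_pM; rewrite ?expR_ge0//.
    by rewrite mulr_ge0 ?(ltW W0)// ltW// barrier_gt0.
  by rewrite ler_wpM2l// ltW.
have sq0 : 0 <= \sum_j x 0 j ^+ 2 by apply: sumr_ge0 => j _; exact: sqr_ge0.
have small := smallE _ _ xA t01'.
have eps0 : 0 <= eps.
  have : 0 <= (1 - t) * energy u x t by rewrite mulr_ge0 ?(ltW W0)//; lra.
  by lra.
(* At t = 0 the barrier is at most 1 + b <= 2, so Q <= 2 W <= 4 eps < d. *)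
have t_gt0 : 0 < t.
  rewrite lt_neqAle t0 andbT; apply/eqP => t0E.
  have : Q x t <= energy u x t * 2.
    apply: Qle => //; rewrite /barrier -t0E subr0 -[X in _ <= X]/(1 + 1) lerD2l.
    rewrite -[leRHS]mulr1; apply: ler_pM => //; rewrite ?(ltW b0) ?sqr_ge0//.
    by rewrite expr_le1//; lra.
  by move: Qd small; rewrite -t0E; lra.
(* On the sphere the barrier is 1 - t, so Q <= (1 - t) W <= 2 eps < d. *)
have xA' : \sum_j x 0 j ^+ 2 < 2^-1.
  rewrite lt_neqAle xA andbT; apply/eqP => xE.
  have : Q x t <= energy u x t * (1 - t).
    by apply: Qle; [lra|rewrite /barrier xE subrr expr0n mulr0 addr0].
  by move: small; lra.
have t01 : 0 < t < 1 by rewrite t_gt0.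
(* Only strictly earlier times are controlled so far; letting s increase to t gives Q <= d at time
   t, so x maximises Q there. *)
have Qt (y : 'rV[R]_N) : \sum_j y 0 j ^+ 2 <= 2^-1 -> Q y t <= d.
  move=> yA.
  have c := cylinder_continuous cQ (ball1 _ yA) t01.
  have Qc : Q y s @[s --> t^'-] --> Q y t.
    apply: cvg_at_left_filter.
    apply: (@continuous_comp _ _ _ (fun s => (y, s)) (fun p => Q p.1 p.2)) c.
    by apply: (cvg_pair (F := nbhs t) (G := nbhs y) (H := nbhs t));
      [exact: cvg_cst|exact: cvg_id].
  apply: (cvgr_to_le Qc); near=> s; apply/ltW/Qlt => //.
  by near: s; exact: nbhs_left_ge.
have QE : Q x t = d by apply/eqP; rewrite eq_le Qd Qt.
have E0 := expR_gt0 (- C * t).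
have heat := bernstein K0 ureg (ball1 _ xA) t01 (H1 _ _ (ball1 _ xA) t01')
  (H2 _ _ (ball1 _ xA) t01').
rewrite -CE in heat.
have := contact ureg b0 bN xA' t01 heat.
have xmax : \forall y \near x, energy u y t * barrier b y t
    <= energy u x t * barrier b x t.
  have : \forall y \near x, \sum_j (y : 'rV[R]_N) 0 j ^+ 2 < 2^-1.
    exact: (cvgr_lt (F := nbhs x) _ (@continuous_sqnorm R N x)).
  apply: (filterS (F := nbhs x)) => y /ltW/Qt; rewrite -QE /Q.
  by rewrite ler_pM2r.
have tmax : \forall s \near t, s < t -> Q x s <= Q x t.
  apply: (filterS (F := nbhs t)) (near_itvoo01 t01) => s /andP[s0 _] st.
  by rewrite QE ltW// Qlt// ltW.
move=> /(_ xmax tmax); apply/negP; rewrite -ltNge.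
have dE : energy u x t * barrier b x t * expR (- C * t) = d := QE.
have EC : expR (- C) <= expR (- C * t).
  by rewrite ler_expR mulNr lerN2 ler_piMr// ltW.
have WB0 : 0 < energy u x t * barrier b x t by rewrite mulr_gt0// barrier_gt0.
rewrite -(@ltr_pM2r _ (expR (- C))) ?expR_gt0//.
(* As t < 1, C W g e^(-C) <= C W g e^(-C t) = C d, while d was chosen to make e^(-C) / 2 = 2 C d,
   which is larger. *)
have -> : 2^-1 * expR (- C) = 2 * (C * d) by rewrite dE0; field; lra.
have : C * (energy u x t * barrier b x t) * expR (- C) <= C * d.
  by rewrite -dE -mulrA ler_wpM2l ?(ltW C0)// ler_wpM2l// ltW.
have : 0 < C * d by rewrite mulr_gt0// dE0 divr_gt0 ?expR_gt0//; lra.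
by lra.
Unshelve. all: by end_near. Qed.

(** * Absence of blow-up and conclusion *)

Lemma not_blows_up_at0 (R : realType) (N : nat) (f : 'rV[R]_N -> R -> R)
    (r B : R) : 0 < r ->
  (forall (x : 'rV[R]_N) (t : R), enorm x <= r -> 0 <= t < 1 ->
    `|f x t| <= B) ->
  ~ blows_up_at f 0 1.
Proof.
move=> r0 fB [p [pcyl p0 fp]].
have e0 : enorm (0 : 'rV[R]_N) < r.
  by rewrite /enorm big1 ?sqrtr0// => i _; rewrite mxE expr0n.
have near0 : \forall q \near ((0, 1) : 'rV[R]_N * R), enorm q.1 < r.
  exact: (@cvg_fst _ _ (nbhs (0 : 'rV[R]_N)) (nbhs (1 : R)) _ _
    (near_enorm_lt e0)).
have pr : \forall n \near \oo, enorm (p n).1 < r by exact: (p0 _ near0).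
have pB : \forall n \near \oo, B < `|f (p n).1 (p n).2|.
  by move/cvgryPgt : fp; exact.
have [n [pn Bn]] := filter_ex (filterI pr pB).
have := fB (p n).1 (p n).2 (ltW pn) (proj2 (pcyl n)).
by rewrite leNgt Bn.
Qed.

Unset Implicit Arguments.

Theorem proposition3p6 (R : realType) (N : nat) (hN : (1 <= N)%N)
    (K : R) (hK : 0 < K) :
  exists eps C : R, [/\ 0 < eps, 0 < C &
    forall u : 'rV[R]_N -> R -> R,
      classically_regular u ->
      (forall (x : 'rV[R]_N) (t : R), enorm x < 1 -> 0 <= t < 1 ->
        `|heat_op u x t|
          <= K * (1 + expR (u x t) + enorm (grad (u ^~ t) x) ^+ 2)) ->
      (forall (x : 'rV[R]_N) (t : R), enorm x < 1 -> 0 <= t < 1 ->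
        enorm (grad (heat_op u ^~ t) x)
          <= K * enorm (grad (fun y => expR (u y t)
                                       + enorm (grad (u ^~ t) y) ^+ 2) x)) ->
      (forall (x : 'rV[R]_N) (t : R), enorm x < 1 -> 0 <= t < 1 ->
        (1 - t) * expR (u x t) + Num.sqrt (1 - t) * enorm (grad (u ^~ t) x)
          <= eps) ->
      [/\ (forall (x : 'rV[R]_N) (t : R), enorm x <= 8^-1 -> 0 <= t < 1 ->
             expR (u x t) + enorm (grad (u ^~ t) x) <= C * eps),
          ~ blows_up_at (fun x t => expR (u x t)) 0 1
        & ~ blows_up_at (fun x t => enorm (grad (u ^~ t) x)) 0 1]].
Proof.
(* [A] is the constant of [bernstein], [b] that of [contact_algebra]. [M] comes from W (b / 8)
   e^(-A) < d, where b / 8 bounds the barrier below on |x| <= 1/8. *)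
pose A := 2 * K + 2 * K ^+ 2; pose b : R := (4 * (N%:R + 8))^-1.
pose d := expR (- A) / (4 * A); pose M := 2 / (A * b).
have A0 : 0 < A by rewrite addr_gt0// mulr_gt0// exprn_gt0.
have N0 : 0 <= N%:R :> R by exact: ler0n.
have b0 : 0 < b by rewrite invr_gt0; lra.
have d0 : 0 < d by rewrite divr_gt0 ?expR_gt0//; lra.
have M0 : 0 < M by rewrite divr_gt0// mulr_gt0.
pose eps := Num.min 1 (d / 8).
have eps0 : 0 < eps by rewrite lt_min ltr01 divr_gt0.
have eps1 : eps <= 1 by rewrite ge_min lexx.
have epsd : 4 * eps < d.
  have : eps <= d / 8 by rewrite ge_min lexx orbT.
  by lra.
have B0 : 0 < 2 * M + 1 by lra.
(* C eps is then 2 M + 1, the sum of the bounds M for e^u and M + 1 for |grad u|. *)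
exists eps, ((2 * M + 1) / eps); split=> //; first by rewrite divr_gt0.
move=> u ureg H1 H2 H3; rewrite divfK ?gt_eqF//.
have bound (x : 'rV[R]_N) (t : R) : enorm x <= 8^-1 -> 0 <= t < 1 ->
    expR (u x t) <= M /\ enorm (grad (u ^~ t) x) <= M + 1.
  move=> x8 t01; case/andP: (t01) => t0 t1.
  have x64 : \sum_j x 0 j ^+ 2 <= 64^-1.
    have -> : 64^-1 = 8^-1 ^+ 2 :> R by field.
    by rewrite -sqr_enorm ler_pXn2r// nnegrE ?enorm_ge0.
  have xh : \sum_j x 0 j ^+ 2 <= 2^-1 by lra.
  have Q := energy_barrier_lt erefl erefl erefl hK ureg eps1 epsd H1 H2 H3
    xh t01.
  rewrite -/A -/b -/d in Q.
  have E0 : expR (- A) <= expR (- A * t).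
    by rewrite ler_expR mulNr lerN2 ler_piMr// ltW.
  (* For |x|^2 <= 1/64 the square in the barrier is at least (31/64)^2 > 1/8; discarding 1 - t > 0
     makes the bound uniform up to t = 1. *)
  have g0 : b / 8 <= barrier b x t.
    have : 8^-1 <= (2^-1 - \sum_j x 0 j ^+ 2) ^+ 2.
      have : 0 <= (64^-1 - \sum_j x 0 j ^+ 2) * (2^-1 - \sum_j x 0 j ^+ 2).
        by rewrite mulr_ge0; lra.
      by lra.
    by move=> /(ler_wpM2l (ltW b0)); rewrite /barrier; lra.
  have W0 := energy_gt0 u x t.
  have WM : energy u x t < M.
    have : energy u x t * (b / 8) * expR (- A) < d.
      apply: le_lt_trans Q; apply: ler_pM; rewrite ?expR_ge0//.
        by rewrite mulr_ge0 ?(ltW W0)//; lra.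
      by rewrite ler_wpM2l// ltW.
    rewrite /d mulrC ltr_pM2l ?expR_gt0// => WA.
    rewrite /M ltr_pdivlMr ?mulr_gt0//.
    have := WA; rewrite -(ltr_pM2r A0).
    have -> : (4 * A)^-1 * A = 4^-1 by field; lra.
    by lra.
  have e0 := expR_gt0 (u x t).
  have s0 : 0 <= \sum_j dx j u x t ^+ 2.
    by apply: sumr_ge0 => j _; exact: sqr_ge0.
  split; first by move: WM; rewrite /energy; lra.
  (* |grad u|^2 <= M <= (M + 1)^2, which avoids the square root of M. *)
  rewrite -(@ler_pXn2r _ 2%N)// ?nnegrE ?enorm_ge0//; last by lra.
  rewrite sqr_enorm_grad; have := mulr_gt0 M0 M0.
  by move: WM; rewrite /energy; lra.
split.
- by move=> x t x8 t01; have [] := bound x t x8 t01; lra.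
- apply: (@not_blows_up_at0 _ _ _ 8^-1 M) => // x t x8 t01.
  by rewrite ger0_norm ?expR_ge0//; case: (bound x t x8 t01).
- apply: (@not_blows_up_at0 _ _ _ 8^-1 (M + 1)) => // x t x8 t01.
  by rewrite ger0_norm ?enorm_ge0//; case: (bound x t x8 t01).
Qed.
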